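(* A principal ideal $tO$ (with $t\in O$) lies properly between $\mathfrak{F}$ and $\mathfrak{F}^2$ if and only if $t = f w$ for a suitable unit $w$ of $D$. Moreover, for units $w,w'$ of $D$, $f w O = f w' O$ if and only if $w/w' \in O$.
   Context: Let $d$ be a square-free integer ($d\neq 1$), $K=\mathbb{Q}(\sqrt d)$ and $D=\mathbb{Z}[\omega]$ its ring of integers, where $\omega=\sqrt d$ if $d\equiv 2,3 \pmod 4$ and $\omega=(1+\sqrt d)/2$ if $d\equiv 1\pmod 4$. Let $f$ be a prime number and $O=\mathbb{Z}[f\omega]$, the unique order of $K$ with $[D:O]=f$. The conductor of $O$ is $\mathfrak{F}=\{x\in O: xD\subseteq O\}=fD$; it is a prime ideal of $O$. ''$tO$ lies properly between $\mathfrak{F}$ and $\mathfrak{F}^2$'' means $\mathfrak{F}^2\subsetneq tO\subsetneq\mathfrak{F}$. *)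

(* Defs.v *)
From HB Require Import structures.
From mathcomp Require Import all_boot all_order all_algebra all_field.
From mathcomp Require Import classical_sets.

Set Implicit Arguments.
Unset Strict Implicit.
Unset Printing Implicit Defensive.

Import GRing.Theory.
Local Open Scope ring_scope.
Local Open Scope classical_set_scope.

Definition squarefreez (d : int) : Prop :=
  forall m : int, (m ^+ 2 %| d)%Z -> `|m|%N = 1%N.

(* K = Q(s) with s ^ 2 = d; as K is a finite extension of rat, the subalgebra
   generated by s is the subfield generated by s. *)
Definition is_quadratic_field (d : int) (K : fieldExtType rat) (s : K) : Prop :=
  s ^+ 2 = d%:~R /\ (<<1; s>> = fullv)%VS.

Definition quad_omega (d : int) (K : fieldExtType rat) (s : K) : K :=
  if (d == 1 %[mod 4])%Z then (1 + s) / 2%:R else s.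

(* The subring Z[x] of K. *)
Definition Zadjoin (K : fieldExtType rat) (x : K) : set K :=
  [set y | exists p : {poly int}, y = (map_poly intr p).[x]].

Definition principal_ideal (K : fieldExtType rat) (O : set K) (t : K) : set K :=
  [set t * x | x in O].

Definition conductor (K : fieldExtType rat) (O D : set K) : set K :=
  [set x | O x /\ forall y, D y -> O (x * y)].

Definition ideal_mul (K : fieldExtType rat) (I J : set K) : set K :=
  [set x | exists (n : nat) (a b : 'I_n -> K),
     (forall i, I (a i) /\ J (b i)) /\ x = \sum_(i < n) a i * b i].

Definition units_in (K : fieldExtType rat) (D : set K) : set K :=
  [set w | D w /\ exists2 v, D v & w * v = 1].

(* Main.v *)
Require Import Defs.
From mathcomp Require Import all_boot all_order all_algebra all_field.
From mathcomp Require Import classical_sets.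
From mathcomp Require Import ring.

(** Write w for omega and w ^ 2 = T w - n with integers T and n. As 1 and w are
    linearly independent over Z, every computation takes place on integer
    coordinates: D = Z + Z w, O = Z + Z f w, F = f D and F ^ 2 = f ^ 2 D
    ([conductorP], [conductor_sqrP]).

    Let t O lie properly between F ^ 2 and F. Then t = f x with x in D, and
    f D is contained in x O. The natural argument compares indices:
    [D : x O] = f |N(x)| must divide [D : f D] = f ^ 2 properly. It is run here
    with determinants ([unit_or_fD]): writing f = x o and f w = x o' with o and
    o' in O, the coordinates of o and o' on (1, f w) form an integer matrix P
    with N(x) det P = f. As f is prime, either N(x) is 1 or -1 and x is a unit,
    or det P is 1 or -1; then (f, f w) spans x O, so x O = f D and t O = F ^ 2,
    which is excluded.

    Conversely, if x is a unit of D, then F = x F and F ^ 2 = x F ^ 2, so the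
    two inclusions around f x O follow from f D being properly contained in O
    and O in D.

    Finally f x O = f y O says that x / y is a unit of O. Membership of x / y in
    O is enough, because a unit of D that lies in O has its inverse in O
    ([order_inverse]). *)

Set Implicit Arguments.
Unset Strict Implicit.
Unset Printing Implicit Defensive.

Import GRing.Theory Num.Theory.

Local Open Scope ring_scope.
Local Open Scope classical_set_scope.

(** * The ring Z[x] *)

Section Zadjoin.
Variables (K : fieldExtType rat) (x : K).

Lemma Zadjoin_int (m : int) : Zadjoin x m%:~R.
Proof. by exists m%:P; rewrite map_polyC hornerC. Qed.

Lemma Zadjoin1 : Zadjoin x 1.
Proof. exact: (Zadjoin_int 1). Qed.

Lemma Zadjoin_gen : Zadjoin x x.
Proof. by exists 'X; rewrite map_polyX hornerX. Qed.

Lemma ZadjoinD (y z : K) : Zadjoin x y -> Zadjoin x z -> Zadjoin x (y + z).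
Proof. by move=> [p ->] [q ->]; exists (p + q); rewrite rmorphD hornerD. Qed.

Lemma ZadjoinM (y z : K) : Zadjoin x y -> Zadjoin x z -> Zadjoin x (y * z).
Proof. by move=> [p ->] [q ->]; exists (p * q); rewrite rmorphM hornerM. Qed.

Lemma Zadjoin_sum (n : nat) (y : 'I_n -> K) :
  (forall i, Zadjoin x (y i)) -> Zadjoin x (\sum_(i < n) y i).
Proof.
move=> xy; elim/big_ind: _ => [|u v|i _]; [exact: (Zadjoin_int 0) | | exact: xy].
exact: ZadjoinD.
Qed.

Lemma Zadjoin_quadratic (T n : int) :
  x ^+ 2 = T%:~R * x - n%:~R ->
  forall y, Zadjoin x y <-> exists a b : int, y = a%:~R + b%:~R * x.
Proof.
move=> xx y; split=> [[p ->]|[a [b ->]]]; last first.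
  apply: ZadjoinD; first exact: Zadjoin_int.
  by apply: ZadjoinM; [exact: Zadjoin_int | exact: Zadjoin_gen].
elim/poly_ind: p => [|p c [a [b pE]]].
  by exists 0, 0; rewrite rmorph0 horner0; ring.
exists (c - b * n), (a + b * T).
rewrite rmorphD rmorphM /= map_polyX map_polyC hornerMXaddC pE mulrDl -mulrA.
by rewrite -expr2 xx; ring.
Qed.

End Zadjoin.

(** * Linear independence of 1 and omega *)

(** The integral form of the linear independence of 1 and x over rat. *)
Definition int_free (K : fieldExtType rat) (x : K) : Prop :=
  forall a b : int, a%:~R + b%:~R * x = 0 -> a = 0 /\ b = 0.

Lemma intr_injK (K : fieldExtType rat) : injective (intr : int -> K).
Proof.
move=> a b; rewrite -(rmorph_int (in_alg K)) -[RHS](rmorph_int (in_alg K)).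
by move=> /fmorph_inj /intr_inj.
Qed.

Lemma natr_neq0 (K : fieldExtType rat) (m : nat) : (0 < m)%N -> m%:R != 0 :> K.
Proof.
by rewrite lt0n; apply: contraNneq => m0; have [->] := @intr_injK K m 0 m0.
Qed.

Lemma sqr_absz1 (m : int) : `|m|%N = 1%N -> m ^+ 2 = 1.
Proof. by move=> m1; rewrite -(real_normK (num_real m)) -abszE m1. Qed.

(** If a + b s = 0 with b nonzero, then a ^ 2 = b ^ 2 d, so b divides a and d is
    the square of a / b; d being square-free, a / b is 1 or -1 and d is 1. *)
Lemma int_free_sqrt (d : int) (K : fieldExtType rat) (s : K) :
  squarefreez d -> d <> 1 -> s ^+ 2 = d%:~R -> int_free s.
Proof.
move=> dsf d1 ss a b abs.
suff b0 : b = 0.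
  by split=> //; move: abs; rewrite b0 mul0r addr0 => /(@intr_injK K a 0).
apply/eqP/negPn/negP=> b0; apply: d1.
have aa : a ^+ 2 = b ^+ 2 * d.
  apply: (@intr_injK K); rewrite !(rmorphM, rmorphXn) /= -ss -exprMn.
  by rewrite (_ : b%:~R * s = - a%:~R) ?sqrrN //; apply: (addrI a%:~R); rewrite abs subrr.
have /dvdzP[c cE] : (b %| a)%Z by rewrite -(@dvdz_pexp2r _ _ 2) // aa dvdz_mulr.
have dE : d = c ^+ 2.
  apply: (mulfI (expf_neq0 2 b0)); rewrite -aa cE; ring.
have c1 : `|c|%N = 1%N by apply: dsf; rewrite dE.
by rewrite dE sqr_absz1.
Qed.

Lemma int_free_quad_omega (d : int) (K : fieldExtType rat) (s : K) :
  int_free s -> int_free (quad_omega d s).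
Proof.
move=> sfree a b; rewrite /quad_omega; case: ifP => [_|_]; last exact: sfree.
have two0 : 2%:R != 0 :> K by apply: natr_neq0.
move=> /(congr1 (fun z => 2%:R * z)) ab.
have [] := sfree (2 * a + b) b.
  by rewrite -[RHS](mulr0 2%:R) -ab; field.
move=> + b0; rewrite b0 addr0 => /eqP.
by rewrite mulf_eq0 /= => /eqP.
Qed.

(** When d = 1 + 4 m, the minimal polynomial of omega is X ^ 2 - X - m. *)
Lemma quad_omega_quadratic (d : int) (K : fieldExtType rat) (s : K) :
  s ^+ 2 = d%:~R ->
  exists T n : int, quad_omega d s ^+ 2 = T%:~R * quad_omega d s - n%:~R.
Proof.
move=> ss; rewrite /quad_omega; case: ifP => [|_]; last first.
  by exists 0, (- d); rewrite ss; ring.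
rewrite eqz_mod_dvd => /dvdzP[m dE].
exists 1, (- m).
have two0 : 2%:R != 0 :> K by apply: natr_neq0.
have four0 : 4%:R != 0 :> K by apply: natr_neq0.
have {}ss : s ^+ 2 = 1 + 4%:R * m%:~R by rewrite ss -[d](subrK 1) dE; ring.
have -> : ((1 + s) / 2%:R) ^+ 2 = (1 + 2%:R * s + s ^+ 2) / 4%:R :> K.
  by field; rewrite four0.
by rewrite ss; field; rewrite two0.
Qed.

(** * The order of conductor f *)

Section Order.
Variables (K : fieldExtType rat) (w : K) (T n : int) (f : nat).
Hypothesis ww : w ^+ 2 = T%:~R * w - n%:~R.
Hypothesis wfree : int_free w.
Hypothesis f_prime : prime f.

Let D := Zadjoin w.
Let O := Zadjoin (f%:R * w).
Let F := conductor O D.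

Lemma coord_inj (a b a' b' : int) :
  a%:~R + b%:~R * w = a'%:~R + b'%:~R * w -> a = a' /\ b = b'.
Proof.
move=> e; have [] := wfree (a := a - a') (b := b - b').
  by apply: (addIr (a'%:~R + b'%:~R * w)); rewrite add0r -[RHS]e; ring.
by move=> /eqP + /eqP; rewrite !subr_eq0 => /eqP-> /eqP->.
Qed.

Lemma coord_mul (a b a' b' : int) :
  (a%:~R + b%:~R * w) * (a'%:~R + b'%:~R * w) =
  (a * a' - b * b' * n)%:~R + (a * b' + b * a' + b * b' * T)%:~R * w.
Proof.
transitivity (a%:~R * a'%:~R + (a%:~R * b'%:~R + b%:~R * a'%:~R) * w
              + b%:~R * b'%:~R * w ^+ 2); first by ring.
by rewrite ww; ring.
Qed.

Lemma f_nonunit (a : int) : f%:Z * a <> 1.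
Proof.
move=> /(congr1 absz)/eqP; rewrite abszM muln_eq1 => /andP[/eqP /= f1 _].
by move: f_prime; rewrite f1.
Qed.

Lemma f_neq0 : f%:R != 0 :> K.
Proof. by apply: natr_neq0; apply: prime_gt0. Qed.

Lemma DP (y : K) : D y <-> exists a b : int, y = a%:~R + b%:~R * w.
Proof. exact: (Zadjoin_quadratic ww). Qed.

Lemma OP (y : K) : O y <-> exists a b : int, y = a%:~R + (b * f%:Z)%:~R * w.
Proof.
have fwfw : (f%:R * w) ^+ 2 = (f%:Z * T)%:~R * (f%:R * w) - (f%:Z ^+ 2 * n)%:~R.
  by rewrite exprMn ww; ring.
have E (a b : int) :
    a%:~R + b%:~R * (f%:R * w) = a%:~R + (b * f%:Z)%:~R * w by ring.
rewrite /O (Zadjoin_quadratic fwfw).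
by split=> -[a [b ->]]; exists a, b; rewrite E.
Qed.

Lemma subOD : O `<=` D.
Proof. by move=> y /OP[a [b ->]]; apply/DP; exists a, (b * f%:Z). Qed.

Lemma fD_sub_O (y : K) : D y -> O (f%:R * y).
Proof.
by move=> /DP[a [b ->]]; apply/OP; exists (a * f%:Z), b; ring.
Qed.

(** O is a proper subset of D. *)
Lemma w_notin_O : ~ O w.
Proof.
move=> /OP[a [b wE]].
have [_ bf1] : 0 = a /\ 1 = b * f%:Z by apply: coord_inj; rewrite -wE; ring.
by apply: (@f_nonunit b); rewrite mulrC.
Qed.

(** f D is a proper subset of O. *)
Lemma one_notin_fD (y : K) : D y -> f%:R * y <> 1.
Proof.
move=> /DP[a [b ->]] fy.
have [/f_nonunit //] : f%:Z * a = 1 /\ f%:Z * b = 0.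
  by apply: coord_inj; transitivity (1 : K); [rewrite -[RHS]fy|]; ring.
Qed.

(** For y = a + b f w in O, the coordinate of y w on w is a + b f T; if y w is
    in O, then f divides it, hence f divides a. *)
Lemma conductorP (y : K) : F y <-> exists2 z, D z & y = f%:R * z.
Proof.
split=> [[/OP[a [b yE]] yD]|[z Dz ->]]; last first.
  split; first exact: fD_sub_O.
  by move=> u Du; rewrite -mulrA; apply/fD_sub_O/ZadjoinM.
have /OP[c [e ywE]] := yD w (Zadjoin_gen w).
have [_ aE] : 0 * a - 1 * (b * f%:Z) * n = c /\
              0 * (b * f%:Z) + 1 * a + 1 * (b * f%:Z) * T = e * f%:Z.
  by apply: coord_inj; rewrite -coord_mul -ywE yE; ring.
exists ((e - b * T)%:~R + b%:~R * w); first by apply/DP; exists (e - b * T), b.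
have {}aE : a = (e - b * T) * f%:Z by rewrite mulrBl -aE; ring.
by rewrite yE aE; ring.
Qed.

Lemma conductor_sqrP (y : K) :
  ideal_mul F F y <-> exists2 z, D z & y = f%:R ^+ 2 * z.
Proof.
split=> [[m [a [b [Fab ->]]]]|[z Dz ->]]; last first.
  exists 1%N, (fun=> f%:R * z), (fun=> f%:R * 1); split.
    by move=> _; split; apply/conductorP; [exists z|exists 1 => //; exact: Zadjoin1].
  by rewrite big_ord1; ring.
have fK (u : K) : f%:R ^+ 2 * (u / f%:R ^+ 2) = u by field; exact: f_neq0.
(* Each product a i * b i is f ^ 2 times an element of D. *)
exists (\sum_(i < m) a i * b i / f%:R ^+ 2); last first.
  by rewrite -mulr_suml fK.
apply: Zadjoin_sum => i; have [/conductorP[u Du ->] /conductorP[v Dv ->]] := Fab i.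
rewrite (_ : _ / _ = u * v); first exact: ZadjoinM.
by field; exact: f_neq0.
Qed.

(** The integer is the norm N of a + b w, and the inverse is N times the
    conjugate a + b T - b w. *)
Lemma unit_of_norm (a b : int) :
  `|(a ^+ 2 + a * b * T + b ^+ 2 * n)%R|%N = 1%N ->
  units_in D (a%:~R + b%:~R * w).
Proof.
set N := (X in absz X) => N1.
split; first by apply/DP; exists a, b.
exists ((N * (a + b * T))%:~R + (- (N * b))%:~R * w).
  by apply/DP; eexists; eexists.
have NN : N * N = 1 by rewrite -expr2 sqr_absz1.
rewrite coord_mul; transitivity ((N * N)%:~R + 0%:~R * w : K).
  by congr (_%:~R + _%:~R * _); rewrite /N; ring.
by rewrite NN mul0r addr0.
Qed.

(** With u = a + b f w and v = c + e w, the equation u v = 1 gives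
    a c - b f e n = 1, and that f divides a e. Modulo f, a is therefore
    invertible and e vanishes. *)
Lemma order_inverse (u v : K) : O u -> D v -> u * v = 1 -> O v.
Proof.
move=> /OP[a [b ->]] /DP[c [e ->]]; rewrite coord_mul => uv1.
have [e1 e2] : a * c - b * f%:Z * e * n = 1 /\
               a * e + b * f%:Z * c + b * f%:Z * e * T = 0.
  by apply: coord_inj; rewrite uv1; ring.
(* The second witness is e / f: expand e (a c - b f e n), which is e, and
   replace a e by - b f (c + e T). *)
apply/OP; exists c, (- b * (c ^+ 2 + c * e * T + e ^+ 2 * n)).
congr (_ + _%:~R * _).
transitivity (e * (a * c - b * f%:Z * e * n)); first by rewrite e1 mulr1.
rewrite -[RHS]addr0 -(mulr0 c) -e2; ring.
Qed.

(** The hypotheses say that x O contains f D. Multiplication by x sends the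
    basis (1, f w) of O to a pair of determinant f N(x) on (1, w), and the matrix
    of coordinates of o and o' on (1, f w) sends this pair to (f, f w); comparing
    determinants, f N(x) det = f ^ 2. *)
Lemma unit_or_fD (x : K) :
  D x -> (exists2 o, O o & x * o = f%:R) -> (exists2 o, O o & x * o = f%:R * w) ->
  units_in D x \/ exists2 z, D z & x = f%:R * z.
Proof.
move=> /DP[a [b xE]] [o /OP[p [q oE]] xo] [o' /OP[p' [q' oE']] xo'].
have [e1 e2] : a * p - b * (q * f%:Z) * n = f%:Z /\
               a * (q * f%:Z) + b * p + b * (q * f%:Z) * T = 0.
  by apply: coord_inj; rewrite -coord_mul -xE -oE xo; ring.
have [e3 e4] : a * p' - b * (q' * f%:Z) * n = 0 /\
               a * (q' * f%:Z) + b * p' + b * (q' * f%:Z) * T = f%:Z.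
  by apply: coord_inj; rewrite -coord_mul -xE -oE' xo'; ring.
pose N := a ^+ 2 + a * b * T + b ^+ 2 * n.
pose det := p * q' - p' * q.
have f0 : f%:Z != 0 by rewrite -lt0n prime_gt0.
have NdetE : N * det = f%:Z.
  apply: (mulfI f0).
  (* The determinant of (x o, x o'), that is of (f, f w). *)
  transitivity ((a * p - b * (q * f%:Z) * n) *
                (a * (q' * f%:Z) + b * p' + b * (q' * f%:Z) * T) -
                (a * p' - b * (q' * f%:Z) * n) *
                (a * (q * f%:Z) + b * p + b * (q * f%:Z) * T)).
    by rewrite /N /det; ring.
  by rewrite e1 e2 e3 e4; ring.
have : (`|N| * `|det|)%N = f by rewrite -abszM NdetE.
have [_ f_div] := primeP f_prime.
move=> Ndet; have := f_div `|N|%N; rewrite -{1}Ndet dvdn_mulr // => /(_ isT).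
case/orP=> /eqP absN; first by left; rewrite xE; apply: unit_of_norm.
right.
have absdet : `|det|%N = 1%N.
  by apply/eqP; rewrite -(eqn_pmul2l (prime_gt0 f_prime)) muln1 -{1}absN Ndet.
have detdet : det * det = 1 by rewrite -expr2 sqr_absz1.
(* Cramer's rule: eliminating f w from f = x (p + q f w) and
   f w = x (p' + q' f w) gives x det = f (q' - q w). *)
exists ((det * q')%:~R + (- (det * q))%:~R * w); first by apply/DP; eexists; eexists.
have xdet : x * det%:~R = f%:R * (q'%:~R - q%:~R * w).
  transitivity (q'%:~R * (x * o) - q%:~R * (x * o')).
    by rewrite oE oE' /det; ring.
  by rewrite xo xo'; ring.
transitivity (x * det%:~R * det%:~R).
  by rewrite -mulrA -rmorphM /= detdet mulr1.
by rewrite xdet; ring.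
Qed.

Lemma between_iff_unit (t : K) :
  (ideal_mul F F `<` principal_ideal O t /\ principal_ideal O t `<` F)
  <-> exists2 x : K, units_in D x & t = f%:R * x.
Proof.
have f0 := f_neq0.
split=> [[[FFt tFF] [tF _]]|[x [Dx [v Dv xv]] ->]].
  have /conductorP[x Dx tE] : F t.
    by apply: tF; exists 1; [exact: Zadjoin1 | rewrite mulr1].
  have f_in z : D z -> exists2 o, O o & x * o = f%:R * z.
    move=> Dz; have [|o Oo toE] := FFt (f%:R ^+ 2 * z).
      by apply/conductor_sqrP; exists z.
    by exists o => //; apply: (mulfI f0); rewrite mulrA -tE toE; ring.
  exists x => //.
  case: (unit_or_fD Dx) => [| |//|[z Dz xE]].
  - by have [o Oo oE] := f_in 1 (Zadjoin1 w); exists o; rewrite // oE mulr1.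
  - exact/f_in/Zadjoin_gen.
  (* If x is in f D, then t is in f ^ 2 D and t O in F ^ 2. *)
  case: tFF => _ [o Oo <-]; apply/conductor_sqrP; exists (z * o).
    by apply: ZadjoinM => //; apply: subOD.
  by rewrite tE xE; ring.
have x0 : x != 0 by apply: contra_eq_neq xv => ->; rewrite mul0r eq_sym oner_neq0.
split; split.
- move=> _ /conductor_sqrP[z Dz ->]; exists (f%:R * (v * z)).
    exact/fD_sub_O/ZadjoinM.
  by rewrite -[RHS]mulr1 -xv; ring.
- (* If f x were in f ^ 2 D, then x would be in f D, and so would 1. *)
  move=> tFF; have [|z Dz] := (conductor_sqrP (f%:R * x)).1.
    by apply: tFF; exists 1; [exact: Zadjoin1 | rewrite mulr1].
  rewrite expr2 -mulrA => /(mulfI f0) xE.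
  by apply: (@one_notin_fD (z * v)); [exact: ZadjoinM | rewrite mulrA -xE].
- move=> _ [o Oo <-]; apply/conductorP; exists (x * o); last by rewrite mulrA.
  by apply: ZadjoinM => //; apply: subOD.
- (* f x w is in F but not in f x O, since w is not in O. *)
  move=> Ft; have [|o Oo] := Ft (f%:R * x * w).
    apply/conductorP; exists (x * w); last by rewrite mulrA.
    exact/ZadjoinM/Zadjoin_gen.
  have fx0 : f%:R * x != 0 by rewrite mulf_neq0.
  by move=> /(mulfI fx0) oE; apply: w_notin_O; rewrite -oE.
Qed.

Lemma principal_ideal_sub (t u : K) : O u ->
  principal_ideal O (t * u) `<=` principal_ideal O t.
Proof.
by move=> Ou _ [o Oo <-]; exists (u * o); [exact: ZadjoinM | rewrite mulrA].
Qed.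

Lemma principal_ideal_eq_iff (c x y : K) :
  c != 0 -> units_in D x -> units_in D y ->
  principal_ideal O (c * x) = principal_ideal O (c * y) <-> O (x / y).
Proof.
move=> c0 [Dx [x' Dx' xx']] [Dy [y' Dy' yy']].
have neq0 (z z' : K) : z * z' = 1 -> z != 0.
  by move=> zz'; apply: contra_eq_neq zz' => ->; rewrite mul0r eq_sym oner_neq0.
have [x0 y0] := (neq0 _ _ xx', neq0 _ _ yy').
split=> [xy|Oxy].
  have : principal_ideal O (c * y) (c * x).
    by rewrite -xy; exists 1; [exact: Zadjoin1 | rewrite mulr1].
  by move=> [o Oo]; rewrite -mulrA => /(mulfI c0) <-; rewrite mulrC mulKf.
have Oyx : O (y / x).
  apply: (order_inverse Oxy); last by field; rewrite x0.
  have -> : x^-1 = x' by rewrite -[LHS]mulr1 -xx' mulKf.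
  exact: ZadjoinM.
apply/seteqP; split.
  by rewrite (_ : c * x = c * y * (x / y)); [exact: principal_ideal_sub | field].
by rewrite (_ : c * y = c * x * (y / x)); [exact: principal_ideal_sub | field].
Qed.

End Order.

(** * Principal ideals between the conductor and its square *)

Theorem lemma3p4 (d : int) (hd : squarefreez d) (hd1 : d <> 1)
    (K : fieldExtType rat) (s : K) (hK : is_quadratic_field d s)
    (f : nat) (hf : prime f) :
  let omega := quad_omega d s in
  let D := Zadjoin omega in
  let O := Zadjoin (f%:R * omega) in
  let F := conductor O D in
  (forall t : K, O t ->
     (ideal_mul F F `<` principal_ideal O t /\ principal_ideal O t `<` F)
     <-> exists2 w : K, units_in D w & t = f%:R * w)
  /\
  (forall w w' : K, units_in D w -> units_in D w' ->
     principal_ideal O (f%:R * w) = principal_ideal O (f%:R * w')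
     <-> O (w / w')).
Proof.
move=> omega D O F; have [ss _] := hK.
have [T [n ww]] := quad_omega_quadratic ss.
have wfree := int_free_quad_omega (d := d) (int_free_sqrt hd hd1 ss).
split=> [t _|w w' Dw Dw']; first exact: (between_iff_unit ww wfree hf).
exact: (principal_ideal_eq_iff f ww wfree (f_neq0 K hf)).
Qed.
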